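(* Let $\angle A,\angle B,\angle C,\alpha,\beta,\gamma$ be positive real numbers with $\angle A+\angle B+\angle C=\pi$, $\alpha+\beta+\gamma<2\pi$, $\alpha<\beta+\gamma$, $\beta<\gamma+\alpha$ and $\gamma<\alpha+\beta$. Let $\ell_1,\ell_2,\ell_3$ be three non-coplanar lines in $\mathbb{R}^3$ through the origin, such that the angles between $\ell_2$ and $\ell_3$ are $\alpha$ and $\pi-\alpha$, the angles between $\ell_3$ and $\ell_1$ are $\beta$ and $\pi-\beta$, and the angles between $\ell_1$ and $\ell_2$ are $\gamma$ and $\pi-\gamma$. If $\angle A$, $\angle B$ and $\angle C$ do not exceed $\pi/2$, then there exist three distinct points $A\in\ell_1$, $B\in\ell_2$, $C\in\ell_3$ such that the interior angles of the triangle $\triangle ABC$ at $A$, $B$ and $C$ are $\angle A$, $\angle B$ and $\angle C$, respectively.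
   Context: The symbols $\angle A,\angle B,\angle C$ denote given positive real numbers (angles in radians). The origin lies on all three lines, and one of the points $A,B,C$ is allowed to be the origin. *)

(* Defs.v *)
From mathcomp Require Import all_boot all_order all_algebra.
From mathcomp Require Import reals trigo.

Set Implicit Arguments.
Unset Strict Implicit.
Unset Printing Implicit Defensive.

Import Order.TTheory GRing.Theory Num.Theory.

Local Open Scope ring_scope.

Definition dot (R : realType) (n : nat) (u v : 'rV[R]_n) : R :=
  \sum_(i < n) u 0 i * v 0 i.

(* Not [`|u|], which on ['rV[R]_n] is the sup norm. *)
Definition enorm (R : realType) (n : nat) (u : 'rV[R]_n) : R :=
  Num.sqrt (dot u u).

(* Meaningful only for nonzero [u] and [v]. *)
Definition vangle (R : realType) (n : nat) (u v : 'rV[R]_n) : R :=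
  acos (dot u v / (enorm u * enorm v)).

Definition interior_angle (R : realType) (n : nat) (A B C : 'rV[R]_n) : R :=
  vangle (B - A) (C - A).

Definition line_through_origin (R : realType) (n : nat)
    (l : {vspace 'rV[R]_n}) : Prop :=
  \dim l = 1%N.

(* Affine planes are not needed: a plane containing a line through the origin
   is itself a linear subspace. *)
Definition coplanar (R : realType) (n : nat)
    (l1 l2 l3 : {vspace 'rV[R]_n}) : Prop :=
  exists P : {vspace 'rV[R]_n},
    [/\ \dim P = 2%N, (l1 <= P)%VS, (l2 <= P)%VS & (l3 <= P)%VS].

(* [t] is one of the (at most two) angles between the lines [l] and [m]
   meeting at the origin: the angle between some ray of [l] and some ray
   of [m]. *)
Definition angle_between_lines (R : realType) (n : nat)
    (l m : {vspace 'rV[R]_n}) (t : R) : Prop :=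
  exists u v : 'rV[R]_n,
    [/\ u \in l, v \in m, u != 0, v != 0 & t = vangle u v].

Definition angles_between_lines_are (R : realType) (n : nat)
    (l m : {vspace 'rV[R]_n}) (s t : R) : Prop :=
  forall x : R, angle_between_lines l m x <-> x = s \/ x = t.

(* Main.v *)
(** For unit vectors u_i on the lines, put A = x u_1, B = y u_2, C = z u_3.  The
    triangle has the prescribed angles as soon as the vertex products
    (B-A).(C-A), (C-B).(A-B), (A-C).(B-C), which are quadratic forms p, q, r in
    (x, y, z), are proportional, with a positive factor, to
    P = sin B sin C cos A, Q = sin C sin A cos B, S = sin A sin B cos C.
    These numbers are nonnegative because no angle is obtuse, and at most one of
    them vanishes; say S > 0.  So it suffices to find a nontrivial common zero
    of the two forms (S p - P r, S q - Q r).  This pair takes the value -(P, Q)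
    at e_3 and, since P, Q >= 0, the value (P, Q) at some v in the plane of e_1
    and e_2.  On the span of v and e_3 the pair is
    (X^2 - Y^2) (P, Q) + X Y h; adding a third direction with coefficient 1 and
    completing products, a common zero becomes a point of a conic
    X^2 - Y^2 + a X + b Y + c = 0 on a hyperbola X Y = k, which always exists by
    the intermediate value theorem. *)
Require Import Defs.
From mathcomp Require Import all_boot all_order all_algebra.
From mathcomp Require Import reals trigo.
From mathcomp Require Import ring lra.

Set Implicit Arguments.
Unset Strict Implicit.
Unset Printing Implicit Defensive.

Import Order.TTheory GRing.Theory Num.Theory.

Local Open Scope ring_scope.

(** * Real roots, and common zeros of two quadratic forms *)

Lemma quadratic_root (F : rcfType) (b c : F) :
  0 <= b ^+ 2 - 4 * c -> exists x, x ^+ 2 + b * x + c = 0.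
Proof.
move=> D_ge0; exists ((Num.sqrt (b ^+ 2 - 4 * c) - b) / 2).
have := sqr_sqrtr D_ge0; set s := Num.sqrt _ => sE.
have -> : ((s - b) / 2) ^+ 2 + b * ((s - b) / 2) + c
  = (s ^+ 2 - (b ^+ 2 - 4 * c)) / 4 by field.
by rewrite sE subrr mul0r.
Qed.

(** The quartic is negative at 0 and nonnegative at [M], because [M >= 1] lets M^4 = [M] * M^3
    dominate the lower terms. The root found in between is nonzero as [d] is. *)
Lemma quartic_root (F : rcfType) (a b c d : F) :
  d < 0 -> exists2 x, x != 0 & x ^+ 4 + a * x ^+ 3 + b * x ^+ 2 + c * x + d = 0.
Proof.
move=> d_lt0; pose p := 'X^4 + a *: 'X^3 + b *: 'X^2 + c *: 'X + d%:P.
have pE x : p.[x] = x ^+ 4 + a * x ^+ 3 + b * x ^+ 2 + c * x + d.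
  by rewrite /p !hornerE.
pose M := 1 + `|a| + `|b| + `|c| - d.
have [[a0 b0] c0] := (normr_ge0 a, normr_ge0 b, normr_ge0 c).
have M1 : 1 <= M by rewrite /M; lra.
have M0 : 0 <= M by lra.
have ge1X n : 1 <= M ^+ n by exact: exprn_ege1.
have X0 n : 0 <= M ^+ n by exact: exprn_ge0.
have X23 : M ^+ 2 <= M ^+ 3 by exact: ler_weXn2l.
have X13 : M <= M ^+ 3 by rewrite -[leLHS]expr1; exact: ler_weXn2l.
have bnd u t : 0 <= t -> t <= M ^+ 3 -> - (`|u| * M ^+ 3) <= u * t.
  move=> t0 tM; rewrite lerNl -mulNr.
  apply: (le_trans (ler_norm _)); rewrite normrM normrN (ger0_norm t0).
  by rewrite ler_wpM2l.
have pM : 0 <= p.[M].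
  rewrite pE.
  have h1 := bnd a _ (X0 3%N) (lexx _).
  have h2 := bnd b _ (X0 2%N) X23.
  have h3 := bnd c _ M0 X13.
  have h4 : - d <= - d * M ^+ 3.
    by rewrite -[leLHS]mulr1 ler_wpM2l // oppr_ge0 ltW.
  have h5 : M ^+ 4 = (1 + `|a| + `|b| + `|c| - d) * M ^+ 3 by rewrite exprS.
  have h6 := X0 3%N.
  lra.
have p0 : p.[0] <= 0 by rewrite pE !expr0n /= !mulr0 !add0r ltW.
have p0M : p.[0] <= 0 <= p.[M] by rewrite p0.
have [x _ /rootP px] := poly_ivt M0 p0M.
exists x; last by rewrite -pE.
apply/eqP => x0; move: px; rewrite x0 pE !expr0n /= !mulr0 !add0r => d0.
by rewrite d0 ltxx in d_lt0.
Qed.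

(** For nonzero [k], substituting y = k/x and clearing x^2 gives a quartic with constant term -k^2 <
    0. For [k = 0] one coordinate is set to 0, and the sign of [c] decides which choice leaves a
    quadratic with a real root. *)
Lemma hyperbola_pair (F : rcfType) (a b c k : F) :
  exists x y, x ^+ 2 - y ^+ 2 + a * x + b * y + c = 0 /\ x * y = k.
Proof.
have [->|k0] := eqVneq k 0.
  have [c0|/ltW c0] := lerP c 0.
    have [|x xE] := @quadratic_root F a c; first by have := sqr_ge0 a; lra.
    by exists x, 0; split; [rewrite -[RHS]xE; ring | rewrite mulr0].
  have [|y yE] := @quadratic_root F (- b) (- c).
    by have := sqr_ge0 b; nra.
  exists 0, y; split; last by rewrite mul0r.
  transitivity (- (y ^+ 2 + - b * y + - c)); last by rewrite yE oppr0.
  by ring.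
have k2 : - k ^+ 2 < 0 by rewrite oppr_lt0 exprn_even_gt0.
have [x x0 xE] := @quartic_root F a c (b * k) _ k2.
exists x, (k / x); split; last by field.
have -> : x ^+ 2 - (k / x) ^+ 2 + a * x + b * (k / x) + c =
  (x ^+ 4 + a * x ^+ 3 + c * x ^+ 2 + b * k * x - k ^+ 2) / x ^+ 2 by field.
by rewrite xE mul0r.
Qed.

Lemma conic_pair (F : rcfType) (w1 w2 h1 h2 a1 a2 b1 b2 c1 c2 : F) :
  (w1, w2) != 0 ->
  exists x y z, (x, y, z) != 0 /\
    (x ^+ 2 - y ^+ 2) * w1 + x * y * h1 + x * z * a1 + y * z * b1
      + z ^+ 2 * c1 = 0 /\
    (x ^+ 2 - y ^+ 2) * w2 + x * y * h2 + x * z * a2 + y * z * b2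
      + z ^+ 2 * c2 = 0.
Proof.
move=> w0; pose D := w1 * h2 - w2 * h1.
have [D0|D0] := eqVneq D 0.
  (* Here h is a multiple of w, so z = 0 and y = 1 leave a single quadratic, of discriminant t^2 +
     4. *)
  have [t [t1 t2]] : exists t, h1 = t * w1 /\ h2 = t * w2.
    have [w10|w10] := eqVneq w1 0.
      have w20 : w2 != 0.
        by apply: contraNneq w0 => ->; rewrite w10.
      exists (h2 / w2); split; last by field.
      move: D0; rewrite /D w10 mul0r sub0r mulr0 => /eqP.
      by rewrite oppr_eq0 mulf_eq0 (negPf w20) => /eqP.
    exists (h1 / w1); split; first by field.
    have -> : h1 / w1 * w2 = (w1 * h2 - D) / w1 by rewrite /D; field.
    by rewrite D0 subr0; field.
  have [|x xE] := @quadratic_root F t (-1); first by have := sqr_ge0 t; lra.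
  exists x, 1, 0; split.
    by apply/eqP => -[_ /eqP]; rewrite oner_eq0.
  have xE' : x ^+ 2 - 1 + t * x = 0 by rewrite -[RHS]xE; ring.
  rewrite t1 t2; split.
    by transitivity ((x ^+ 2 - 1 + t * x) * w1); [ring | rewrite xE' mul0r].
  by transitivity ((x ^+ 2 - 1 + t * x) * w2); [ring | rewrite xE' mul0r].
(* Cramer's rule: the coordinates of (u, v) in the basis w, h. With z = 1 the system splits into one
   equation along w and one along h. *)
pose cr u v := (u * h2 - v * h1) / D; pose cs u v := (w1 * v - w2 * u) / D.
have crE u v : u = cr u v * w1 + cs u v * h1 by rewrite /cr /cs /D; field.
have csE u v : v = cr u v * w2 + cs u v * h2 by rewrite /cr /cs /D; field.
set A := cr a1 a2; set A' := cs a1 a2; set B := cr b1 b2; set B' := cs b1 b2.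
set C := cr c1 c2; set C' := cs c1 c2.
(* The h-equation is (x + B')(y + A') = A'B' - C'. In the shifted unknowns X = x + B', Y = y + A' it
   is a hyperbola, and the w-equation acquires the coefficients given here. *)
have [X [Y [E1 E2]]] := @hyperbola_pair F (A - 2 * B') (B + 2 * A')
  (B' ^+ 2 - A' ^+ 2 - A * B' - B * A' + C) (A' * B' - C').
pose x := X - B'; pose y := Y - A'.
have e1 : x ^+ 2 - y ^+ 2 + x * A + y * B + C = 0.
  by rewrite -[RHS]E1 /x /y; ring.
have e2 : x * y + x * A' + y * B' + C' = 0.
  transitivity (X * Y - (A' * B' - C')); last by rewrite E2 subrr.
  by rewrite /x /y; ring.
exists x, y, 1; split.
  by apply/eqP => -[_ _ /eqP]; rewrite oner_eq0.
rewrite (crE a1 a2) (crE b1 b2) (crE c1 c2) -/A -/A' -/B -/B' -/C -/C'.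
rewrite (csE a1 a2) (csE b1 b2) (csE c1 c2) -/A -/A' -/B -/B' -/C -/C'.
split.
  transitivity ((x ^+ 2 - y ^+ 2 + x * A + y * B + C) * w1
    + (x * y + x * A' + y * B' + C') * h1); first by ring.
  by rewrite e1 e2 !mul0r addr0.
transitivity ((x ^+ 2 - y ^+ 2 + x * A + y * B + C) * w2
  + (x * y + x * A' + y * B' + C') * h2); first by ring.
by rewrite e1 e2 !mul0r addr0.
Qed.

(** * Vertex products in prescribed ratio *)

(* The condition [m * x * y <= 0] selects, among the two solutions, the one that
   makes the scaling factor in [edge_point] positive. *)
Lemma edge_ratio (F : rcfType) (m P Q : F) :
  0 <= P -> 0 <= Q ->
  exists x y, [/\ (x, y) != 0, m * x * y <= 0 &
    Q * (x ^+ 2 - m * x * y) = P * (y ^+ 2 - m * x * y)].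
Proof.
move=> P0 Q0; have [->|Qn0] := eqVneq Q 0.
  exists 1, 0; split; last by ring.
    by apply/eqP => -[/eqP]; rewrite oner_eq0.
  by rewrite mulr0.
have Qp : 0 < Q by rewrite lt_def Qn0.
(* For y = 1 the equation reads Q x^2 - e x - P = 0. Since [s] is at least |e|, its roots (e +
   s)/(2Q) and (e - s)/(2Q) have weakly opposite signs, and the sign of [m] decides between them. *)
pose e := (Q - P) * m; pose s := Num.sqrt (e ^+ 2 + 4 * (P * Q)).
have PQ0 : 0 <= P * Q by exact: mulr_ge0.
have sE : s ^+ 2 = e ^+ 2 + 4 * (P * Q).
  by rewrite sqr_sqrtr // addr_ge0 ?sqr_ge0 // mulr_ge0.
have les : `|e| <= s.
  by rewrite -sqrtr_sqr ler_wsqrtr // lerDl mulr_ge0.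
have [les1 les2] : e <= s /\ - e <= s.
  by split; apply: le_trans les; [exact: ler_norm | rewrite -normrN ler_norm].
have root t : t ^+ 2 = s ^+ 2 -> Q * (((e + t) / (2 * Q)) ^+ 2
    - m * ((e + t) / (2 * Q)) * 1) = P * (1 ^+ 2 - m * ((e + t) / (2 * Q)) * 1).
  move=> tE; apply/eqP; rewrite -subr_eq0; apply/eqP.
  transitivity ((t ^+ 2 - (e ^+ 2 + 4 * (P * Q))) / (4 * Q)).
    by rewrite /e; field.
  by rewrite tE sE subrr mul0r.
have [m0|/ltW m0] := lerP 0 m.
  exists ((e + - s) / (2 * Q)), 1; split; last by apply: root; rewrite sqrrN.
    by apply/eqP => -[_ /eqP]; rewrite oner_eq0.
  rewrite mulr1 mulr_ge0_le0 // mulr_le0_ge0 //; first by rewrite subr_le0.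
  by rewrite invr_ge0 mulr_ge0.
exists ((e + s) / (2 * Q)), 1; split; last by apply: root.
  by apply/eqP => -[_ /eqP]; rewrite oner_eq0.
rewrite mulr1 mulr_le0_ge0 // divr_ge0 ?mulr_ge0 //.
by rewrite -lerBlDl sub0r.
Qed.

Lemma sqrD_gt0 (F : realDomainType) (x y : F) :
  (x, y) != 0 -> 0 < x ^+ 2 + y ^+ 2.
Proof.
move=> xy0; rewrite lt_def addr_ge0 ?sqr_ge0 // andbT.
rewrite paddr_eq0 ?sqr_ge0 // !sqrf_eq0.
by apply: contraNN xy0 => /andP[/eqP -> /eqP ->].
Qed.

(** This is the vector v = (x, y, 0) where the pair of forms equals (P, Q). The ratio from
    [edge_ratio] gives (p, q) = t (P, Q) with t > 0, so the pair is (S t - r)(P, Q). As r <= 0, the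
    factor is positive, and dividing v by its square root makes it 1. *)
Lemma edge_point (F : rcfType) (m P Q S : F) :
  0 <= P -> 0 <= Q -> 0 < P + Q -> 0 < S ->
  exists x y, [/\ (x, y) != 0,
    S * (x ^+ 2 - m * x * y) - P * (m * x * y) = P &
    S * (y ^+ 2 - m * x * y) - Q * (m * x * y) = Q].
Proof.
move=> P0 Q0 PQ S0; have [x [y [xy0 r0 E]]] := edge_ratio m P0 Q0.
have PQn0 : P + Q != 0 by rewrite gt_eqF.
pose r := m * x * y; pose p := x ^+ 2 - r; pose q := y ^+ 2 - r.
pose t := (p + q) / (P + Q).
have pE : p = P * t.
  transitivity ((P * p + Q * p) / (P + Q)); first by field.
  by rewrite E -/r -/q /t; field.
have qE : q = Q * t.
  transitivity ((P * q + Q * q) / (P + Q)); first by field.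
  by rewrite -E -/r -/p /t; field.
have t0 : 0 < t.
  rewrite divr_gt0 // /p /q; have := sqrD_gt0 xy0; rewrite -/r in r0; lra.
have s0 : 0 < S * t - r.
  have := mulr_gt0 S0 t0; rewrite -/r in r0; lra.
pose c := Num.sqrt (S * t - r).
have cn0 : c != 0 by rewrite gt_eqF // sqrtr_gt0.
have cE : c ^+ 2 = S * t - r by rewrite sqr_sqrtr // ltW.
exists (x / c), (y / c); split.
- apply: contraNneq xy0 => -[/eqP xc /eqP yc]; move: xc yc.
  by rewrite !mulf_eq0 !invr_eq0 (negPf cn0) !orbF => /eqP -> /eqP ->.
- transitivity ((S * p - P * r) / c ^+ 2); first by rewrite /p /r; field.
  rewrite pE; transitivity (P * (S * t - r) / c ^+ 2); first by field.
  by rewrite -cE; field.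
- transitivity ((S * q - Q * r) / c ^+ 2); first by rewrite /q /r; field.
  rewrite qE; transitivity (Q * (S * t - r) / c ^+ 2); first by field.
  by rewrite -cE; field.
Qed.

(* [m1], [m2], [m3] stand for u_2.u_3, u_1.u_3, u_1.u_2. *)
Lemma vertex_products_gt0 (F : rcfType) (m1 m2 m3 P Q S : F) :
  0 <= P -> 0 <= Q -> 0 < P + Q -> 0 < S ->
  exists x y z k, (x, y, z) != 0 /\
    [/\ x ^+ 2 - m3 * x * y - m2 * x * z + m1 * y * z = k * P,
        y ^+ 2 - m1 * y * z - m3 * x * y + m2 * x * z = k * Q &
        z ^+ 2 - m2 * x * z - m1 * y * z + m3 * x * y = k * S].
Proof.
move=> P0 Q0 PQ S0.
have [x0 [y0 [xy0 E1 E2]]] := edge_point m3 P0 Q0 PQ S0.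
have PQn0 : (P, Q) != 0.
  by apply: contraTneq PQ => -[-> ->]; rewrite addr0 ltxx.
(* The arguments are the coefficients of S p - P r and S q - Q r in the basis (x0, y0, 0), e_3,
   (-y0, x0, 0). *)
have [X [Y [Z [XYZ0 [C1 C2]]]]] := conic_pair
  (S * (- m2 * x0 + m1 * y0) + P * (m2 * x0 + m1 * y0))
  (S * (m2 * x0 - m1 * y0) + Q * (m2 * x0 + m1 * y0))
  (S * (- (2 * x0 * y0) - m3 * (x0 ^+ 2 - y0 ^+ 2))
     - P * (m3 * (x0 ^+ 2 - y0 ^+ 2)))
  (S * (2 * x0 * y0 - m3 * (x0 ^+ 2 - y0 ^+ 2))
     - Q * (m3 * (x0 ^+ 2 - y0 ^+ 2)))
  (S * (m2 * y0 + m1 * x0) - P * (m2 * y0 - m1 * x0))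
  (- S * (m2 * y0 + m1 * x0) - Q * (m2 * y0 - m1 * x0))
  (S * (y0 ^+ 2 + m3 * x0 * y0) + P * (m3 * x0 * y0))
  (S * (x0 ^+ 2 + m3 * x0 * y0) + Q * (m3 * x0 * y0)) PQn0.
have d0 := sqrD_gt0 xy0; have dn0 : x0 ^+ 2 + y0 ^+ 2 != 0 by rewrite gt_eqF.
pose x := X * x0 - Z * y0; pose y := X * y0 + Z * x0; pose z := Y.
pose r := z ^+ 2 - m2 * x * z - m1 * y * z + m3 * x * y.
have Sn0 : S != 0 by rewrite gt_eqF.
have g1 : S * (x ^+ 2 - m3 * x * y - m2 * x * z + m1 * y * z) = r * P.
  (* Expanding the coefficient P of X^2 - Y^2 by [E1] makes the X^2 terms match identically; the Y^2
     terms then differ by a multiple of [E1]. *)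
  apply/eqP; rewrite -subr_eq0 -C1 -[X in _ == (_ * X + _ + _ + _ + _)]E1.
  rewrite -subr_eq0; apply/eqP.
  transitivity
    (Y ^+ 2 * (S * (x0 ^+ 2 - m3 * x0 * y0) - P * (m3 * x0 * y0) - P)).
    by rewrite /r /x /y /z; ring.
  by rewrite E1 subrr mulr0.
have g2 : S * (y ^+ 2 - m1 * y * z - m3 * x * y + m2 * x * z) = r * Q.
  apply/eqP; rewrite -subr_eq0 -C2 -[X in _ == (_ * X + _ + _ + _ + _)]E2.
  rewrite -subr_eq0; apply/eqP.
  transitivity
    (Y ^+ 2 * (S * (y0 ^+ 2 - m3 * x0 * y0) - Q * (m3 * x0 * y0) - Q)).
    by rewrite /r /x /y /z; ring.
  by rewrite E2 subrr mulr0.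
exists x, y, z, (r / S); split.
  apply: contraNneq XYZ0 => -[x_0 y_0 z_0].
  have -> : X = (x * x0 + y * y0) / (x0 ^+ 2 + y0 ^+ 2).
    by rewrite /x /y; field.
  have -> : Z = (y * x0 - x * y0) / (x0 ^+ 2 + y0 ^+ 2).
    by rewrite /x /y; field.
  by rewrite x_0 y_0 (z_0 : Y = 0) !mul0r subrr addr0 mul0r.
split.
- by apply: (mulfI Sn0); rewrite g1; field.
- by apply: (mulfI Sn0); rewrite g2; field.
- by rewrite divfK.
Qed.

(** If S = 0, then P > 0, and a cyclic relabelling puts P in the place of S. *)
Lemma vertex_products (F : rcfType) (m1 m2 m3 P Q S : F) :
  0 <= P -> 0 <= Q -> 0 <= S -> 0 < P + Q -> 0 < Q + S -> 0 < S + P ->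
  exists x y z k, (x, y, z) != 0 /\
    [/\ x ^+ 2 - m3 * x * y - m2 * x * z + m1 * y * z = k * P,
        y ^+ 2 - m1 * y * z - m3 * x * y + m2 * x * z = k * Q &
        z ^+ 2 - m2 * x * z - m1 * y * z + m3 * x * y = k * S].
Proof.
move=> P0 Q0; rewrite le_eqVlt => /predU1P[<-|S0] PQ QS SP; last first.
  exact: vertex_products_gt0.
rewrite add0r in SP.
have [x [y [z [k [xyz0 [E1 E2 E3]]]]]] :=
  vertex_products_gt0 m2 m3 m1 Q0 (lexx 0) QS SP.
exists z, x, y, k; split.
  by apply: contraNneq xyz0 => -[-> -> ->].
by split; [rewrite -E3 | rewrite -E1 | rewrite -E2]; ring.
Qed.

(** * Dot products and angles *)

Section Dot.
Variables (R : realType) (n : nat).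
Implicit Types u v w : 'rV[R]_n.

Lemma dotC u v : dot u v = dot v u.
Proof. by apply: eq_bigr => i _; rewrite mulrC. Qed.

Lemma dotBl u v w : dot (u - v) w = dot u w - dot v w.
Proof.
by rewrite /dot -sumrB; apply: eq_bigr => i _; rewrite !mxE mulrBl.
Qed.

Lemma dotBr u v w : dot w (u - v) = dot w u - dot w v.
Proof. by rewrite !(dotC w) dotBl. Qed.

Lemma dotZl a u v : dot (a *: u) v = a * dot u v.
Proof. by rewrite /dot mulr_sumr; apply: eq_bigr => i _; rewrite mxE mulrA. Qed.

Lemma dotZr a u v : dot u (a *: v) = a * dot u v.
Proof. by rewrite !(dotC u) dotZl. Qed.

Lemma dot_ge0 u : 0 <= dot u u.
Proof. by apply: sumr_ge0 => i _; rewrite -expr2 sqr_ge0. Qed.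

Lemma dot_eq0 u : (dot u u == 0) = (u == 0).
Proof.
apply/eqP/eqP => [u0|->]; last by rewrite -[X in dot X _](subrr 0) dotBl subrr.
apply/rowP => i; apply/eqP; rewrite mxE -sqrf_eq0 expr2; apply/eqP.
by apply: (psumr_eq0P _ u0) => // j _; rewrite -expr2 sqr_ge0.
Qed.

Lemma vangle_self u : u != 0 -> vangle u u = 0.
Proof.
move=> u0; rewrite /vangle /enorm -expr2 sqr_sqrtr ?dot_ge0 //.
by rewrite divff ?acos1 // dot_eq0.
Qed.

Lemma line_unit (l : {vspace 'rV[R]_n}) :
  line_through_origin l -> exists2 u, u \in l & dot u u = 1.
Proof.
move=> l1; have l0 : l != 0%VS by rewrite -dimv_eq0 l1.
pose u := vpick l; have u0 : dot u u != 0 by rewrite dot_eq0 vpick0.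
exists ((enorm u)^-1 *: u); first by rewrite memvZ // memv_pick.
have e2 : enorm u ^+ 2 = dot u u by rewrite sqr_sqrtr // dot_ge0.
rewrite dotZl dotZr -e2; field.
by apply: contraNneq u0 => e0; rewrite -e2 e0 expr0n.
Qed.

Lemma interior_angleE (b c k t : R) (A B C : 'rV[R]_n) :
  0 < k -> 0 < b -> 0 < c -> 0 <= t <= pi ->
  dot (C - A) (C - A) = k * b ^+ 2 -> dot (B - A) (B - A) = k * c ^+ 2 ->
  dot (B - A) (C - A) = k * (b * c * cos t) -> interior_angle A B C = t.
Proof.
move=> k0 b0 c0 t01 Eb Ec E; rewrite /interior_angle /vangle /enorm Eb Ec E.
rewrite !(sqrtrM _ (ltW k0)) !sqrtr_sqr !gtr0_norm //.
have s0 : Num.sqrt k != 0 by rewrite gt_eqF // sqrtr_gt0.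
have kE : k = Num.sqrt k ^+ 2 by rewrite sqr_sqrtr // ltW.
rewrite [X in X * (_ * cos t)]kE.
have -> : Num.sqrt k ^+ 2 * (b * c * cos t)
    / (Num.sqrt k * c * (Num.sqrt k * b)) = cos t.
  by field; rewrite s0 !gt_eqF.
by rewrite cosK // in_itv.
Qed.

End Dot.

(** * Construction of the triangle *)

Theorem proposition2 (R : realType)
  (angA angB angC alpha beta gamma : R)
  (angA_gt0 : 0 < angA) (angB_gt0 : 0 < angB) (angC_gt0 : 0 < angC)
  (alpha_gt0 : 0 < alpha) (beta_gt0 : 0 < beta) (gamma_gt0 : 0 < gamma)
  (ang_sum : angA + angB + angC = pi)
  (abc_lt : alpha + beta + gamma < 2 * pi)
  (alpha_lt : alpha < beta + gamma)
  (beta_lt : beta < gamma + alpha)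
  (gamma_lt : gamma < alpha + beta)
  (l1 l2 l3 : {vspace 'rV[R]_3})
  (l1_line : line_through_origin l1)
  (l2_line : line_through_origin l2)
  (l3_line : line_through_origin l3)
  (l123_noncoplanar : ~ coplanar l1 l2 l3)
  (l23_angles : angles_between_lines_are l2 l3 alpha (pi - alpha))
  (l31_angles : angles_between_lines_are l3 l1 beta (pi - beta))
  (l12_angles : angles_between_lines_are l1 l2 gamma (pi - gamma))
  (angA_le : angA <= pi / 2) (angB_le : angB <= pi / 2)
  (angC_le : angC <= pi / 2) :
  exists A B C : 'rV[R]_3,
    [/\ A \in l1, B \in l2 & C \in l3] /\
    [/\ A != B, B != C & C != A] /\
    [/\ interior_angle A B C = angA,
        interior_angle B C A = angB &
        interior_angle C A B = angC].
Proof.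
have [u1 u1l u11] := line_unit l1_line.
have [u2 u2l u22] := line_unit l2_line.
have [u3 u3l u33] := line_unit l3_line.
have sin_ang (t : R) : 0 < t -> t <= pi / 2 -> 0 < sin t.
  by move=> t0 t1; rewrite sin_gt0_pi // t0 /=; have := pi_gt0 R; lra.
have cos_ang (t : R) : 0 < t -> t <= pi / 2 -> 0 <= cos t.
  by move=> t0 t1; apply: cos_ge0_pihalf; rewrite t1 andbT; lra.
have [a0 b0 c0] := And3 (sin_ang _ angA_gt0 angA_le)
  (sin_ang _ angB_gt0 angB_le) (sin_ang _ angC_gt0 angC_le).
have [ca cb cc] := And3 (cos_ang _ angA_gt0 angA_le)
  (cos_ang _ angB_gt0 angB_le) (cos_ang _ angC_gt0 angC_le).
have sin_sum (s t r : R) : s + t + r = pi ->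
    sin r = sin s * cos t + cos s * sin t.
  move=> str; have -> : r = pi - (s + t) by rewrite -str; ring.
  by rewrite sinB sinpi cospi sinD; ring.
set a := sin angA in a0; set b := sin angB in b0; set c := sin angC in c0.
(* By the law of sines, [a], [b], [c] are the sides up to scale, and [P], [Q], [S] are the
   corresponding vertex products. The two products at the ends of a side add up to its square. *)
pose P := b * c * cos angA; pose Q := c * a * cos angB.
pose S := a * b * cos angC.
have PQ : P + Q = c ^+ 2.
  rewrite expr2 {1}/c (sin_sum angA angB) // -/a -/b /P /Q; ring.
have QS : Q + S = a ^+ 2.
  rewrite expr2 {1}/a (sin_sum angB angC) -/b -/c /Q /S; first by ring.
  by rewrite -ang_sum; ring.
have SP : S + P = b ^+ 2.
  rewrite expr2 {1}/b (sin_sum angC angA) -/a -/c /P /S; first by ring.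
  by rewrite -ang_sum; ring.
have [x [y [z [k [xyz0 [EA EB EC]]]]]] : exists x y z k, (x, y, z) != 0 /\
    [/\ x ^+ 2 - dot u1 u2 * x * y - dot u1 u3 * x * z + dot u2 u3 * y * z
          = k * P,
        y ^+ 2 - dot u2 u3 * y * z - dot u1 u2 * x * y + dot u1 u3 * x * z
          = k * Q &
        z ^+ 2 - dot u1 u3 * x * z - dot u2 u3 * y * z + dot u1 u2 * x * y
          = k * S].
  apply: vertex_products; rewrite ?PQ ?QS ?SP ?exprn_gt0 //;
    by rewrite !mulr_ge0 // ltW.
pose A := x *: u1; pose B := y *: u2; pose C := z *: u3.
have dAA : dot A A = x ^+ 2 by rewrite /A dotZl dotZr u11; ring.
have dBB : dot B B = y ^+ 2 by rewrite /B dotZl dotZr u22; ring.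
have dCC : dot C C = z ^+ 2 by rewrite /C dotZl dotZr u33; ring.
have dAB : dot A B = dot u1 u2 * x * y by rewrite /A /B dotZl dotZr; ring.
have dAC : dot A C = dot u1 u3 * x * z by rewrite /A /C dotZl dotZr; ring.
have dBC : dot B C = dot u2 u3 * y * z by rewrite /B /C dotZl dotZr; ring.
have dE := (dotBl, dotBr, dotC B A, dotC C A, dotC C B, dAA, dBB, dCC, dAB,
  dAC, dBC).
have vA : dot (B - A) (C - A) = k * P by rewrite !dE -EA; ring.
have vB : dot (C - B) (A - B) = k * Q by rewrite !dE -EB; ring.
have vC : dot (A - C) (B - C) = k * S by rewrite !dE -EC; ring.
have eC : dot (A - B) (A - B) = k * c ^+ 2.
  by rewrite -PQ mulrDr -vA -vB !dE; ring.
have eA : dot (B - C) (B - C) = k * a ^+ 2.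
  by rewrite -QS mulrDr -vB -vC !dE; ring.
have eB : dot (C - A) (C - A) = k * b ^+ 2.
  by rewrite -SP mulrDr -vC -vA !dE; ring.
have swap (U V : 'rV[R]_3) : dot (V - U) (V - U) = dot (U - V) (U - V).
  by rewrite !dotBl !dotBr; ring.
(* k c^2 is a squared length, so k >= 0; for k = 0 the three points would coincide. *)
have k0 : 0 < k.
  rewrite lt_def; apply/andP; split; last first.
    by have := dot_ge0 (A - B); rewrite eC pmulr_lge0 // exprn_gt0.
  apply: contraNneq xyz0 => k0.
  have AB : A = B by apply/eqP; rewrite -subr_eq0 -dot_eq0 eC k0 mul0r.
  have BC : B = C by apply/eqP; rewrite -subr_eq0 -dot_eq0 eA k0 mul0r.
  (* A nonzero common point would give l2 = l3, hence the angle 0. *)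
  have B0 : B = 0.
    apply/eqP/negP => /negP B0.
    have /l23_angles : angle_between_lines l2 l3 0.
      exists B, B; split; rewrite ?vangle_self //; first exact: memvZ.
      by rewrite BC; exact: memvZ.
    (* [alpha_lt] and [abc_lt] together give alpha < pi, so neither alpha nor pi - alpha is 0. *)
    by case; lra.
  have sq0 (t : R) : t ^+ 2 = 0 -> t = 0.
    by move=> /eqP; rewrite sqrf_eq0 => /eqP.
  move: dAA dBB dCC; rewrite -BC AB B0 -(scale0r B) dotZl mul0r.
  by move=> /esym/sq0 -> /esym/sq0 -> /esym/sq0 ->.
have ne (U V : 'rV[R]_3) s :
    0 < s -> dot (U - V) (U - V) = k * s ^+ 2 -> U != V.
  move=> s0 E; rewrite -subr_eq0 -dot_eq0 E.
  by rewrite mulf_neq0 // ?expf_neq0 // gt_eqF.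
have itv (t : R) : 0 < t -> t <= pi / 2 -> 0 <= t <= pi.
  by move=> t0 t1; rewrite ltW //=; have := pi_gt0 R; lra.
exists A, B, C; split; first by split; exact: memvZ.
split; first by split; [exact: ne eC | exact: ne eA | exact: ne eB].
split.
- by apply: (interior_angleE k0 b0 c0 (itv _ angA_gt0 angA_le) eB _ vA);
    rewrite swap.
- by apply: (interior_angleE k0 c0 a0 (itv _ angB_gt0 angB_le) eC _ vB);
    rewrite swap.
- by apply: (interior_angleE k0 a0 b0 (itv _ angC_gt0 angC_le) eA _ vC);
    rewrite swap.
Qed.
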